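(* Let $d\ge2$, $c>0$, $\beta>0$, and $L\ge2$. Let $\mathcal{H}^{\mathrm{Lap}}$ be the RKHS of the Laplace kernel $k^{\mathrm{Lap}}(\mathbf{x},\mathbf{z})=e^{-c\sqrt{1-\mathbf{x}^T\mathbf{z}}}$ on $\mathbb{S}^{d-1}$, and $\mathcal{H}^{\mathrm{FC}_\beta(m)}$ the RKHS of $k^{\mathrm{FC}_\beta(m)}$ restricted to $\mathbb{S}^{d-1}$. Then, as sets of functions, $\mathcal{H}^{\mathrm{Lap}}=\mathcal{H}^{\mathrm{FC}_\beta(2)}\subseteq\mathcal{H}^{\mathrm{FC}_\beta(L)}$.
   Context: NTK definition: Fix $\beta\ge 0$. For nonzero $\mathbf{x},\mathbf{z}\in\mathbb{R}^d$ define recursively $\Sigma^{(0)}(\mathbf{x},\mathbf{z})=\mathbf{x}^T\mathbf{z}$, $\Theta^{(0)}(\mathbf{x},\mathbf{z})=\mathbf{x}^T\mathbf{z}+\beta^2$, and for $h\ge 1$, with $\lambda^{(h-1)}=\Sigma^{(h-1)}(\mathbf{x},\mathbf{z})/\sqrt{\Sigma^{(h-1)}(\mathbf{x},\mathbf{x})\Sigma^{(h-1)}(\mathbf{z},\mathbf{z})}$, $\Sigma^{(h)}(\mathbf{x},\mathbf{z})=\frac{\lambda^{(h-1)}(\pi-\arccos\lambda^{(h-1)})+\sqrt{1-(\lambda^{(h-1)})^2}}{\pi}\sqrt{\Sigma^{(h-1)}(\mathbf{x},\mathbf{x})\Sigma^{(h-1)}(\mathbf{z},\mathbf{z})}$,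 $\dot\Sigma^{(h)}(\mathbf{x},\mathbf{z})=\frac{\pi-\arccos\lambda^{(h-1)}}{\pi}$, $\Theta^{(h)}=\Theta^{(h-1)}\dot\Sigma^{(h)}+\Sigma^{(h)}+\beta^2$. For $L\ge2$, $k^{\mathrm{FC}_\beta(L)}:=\Theta^{(L-1)}$ (NTK of an $L$-layer fully connected ReLU network with bias initialized at zero). For a zonal positive definite kernel on $\mathbb{S}^{d-1}$ with Mercer expansion $\sum_k\lambda_k\sum_{j=1}^{N(d,k)}Y_{k,j}(\mathbf{x})Y_{k,j}(\mathbf{z})$ ($Y_{k,j}$ orthonormal spherical harmonics w.r.t. the uniform measure, all $\lambda_k>0$), its RKHS is $\{f=\sum_{k,j}\alpha_{k,j}Y_{k,j}:\sum_{k,j}\alpha_{k,j}^2/\lambda_k<\infty\}$. *)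

(* Defs.v *)
From mathcomp Require Import all_boot all_order all_algebra.
From mathcomp Require Import all_classical all_reals all_analysis.
Set Implicit Arguments. Unset Strict Implicit. Unset Printing Implicit Defensive.
Import Order.TTheory GRing.Theory Num.Theory.
Import numFieldNormedType.Exports.
Local Open Scope classical_set_scope.
Local Open Scope ring_scope.

Section Defs.
Variable R : realType.

Definition dotp (d : nat) (x z : 'rV[R]_d) : R := \sum_(i < d) x ord0 i * z ord0 i.

Definition sphere (d : nat) := {x : 'rV[R]_d | dotp x x == 1}.

(** NTK recursion (Sigma^(h), Theta^(h)) for ReLU FC networks with bias beta. *)
Fixpoint Sigma (d : nat) (h : nat) (x z : 'rV[R]_d) {struct h} : R :=
  match h with
  | 0%N => dotp x z
  | h'.+1 =>
      let s := Num.sqrt (Sigma h' x x * Sigma h' z z) in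
      let lam := Sigma h' x z / s in
      (lam * (pi - acos lam) + Num.sqrt (1 - lam ^+ 2)) / pi * s
  end.

Definition Sigmadot (d : nat) (h : nat) (x z : 'rV[R]_d) : R :=
  match h with
  | 0%N => 0 (* not used: only defined for h >= 1 *)
  | h'.+1 =>
      let lam := Sigma h' x z / Num.sqrt (Sigma h' x x * Sigma h' z z) in
      (pi - acos lam) / pi
  end.

Fixpoint Theta (d : nat) (beta : R) (h : nat) (x z : 'rV[R]_d) {struct h} : R :=
  match h with
  | 0%N => dotp x z + beta ^+ 2
  | h'.+1 => Theta beta h' x z * Sigmadot h x z + Sigma h x z + beta ^+ 2
  end.

Definition kFC (d : nat) (beta : R) (L : nat) (x z : sphere d) : R :=
  Theta beta L.-1 (val x) (val z).

Definition kLap (d : nat) (c : R) (x z : sphere d) : R :=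
  expR (- (c * Num.sqrt (1 - dotp (val x) (val z)))).

(** Reproducing kernel Hilbert space of a kernel k on a set X, as a set of
    functions, via the Moore--Aronszajn construction: the pre-Hilbert space
    H0 = span{k(y,.)} with <k(y,.),k(y',.)> = k(y,y'), and H = the set of
    pointwise limits of H0-Cauchy sequences. An element of H0 is encoded as
    a finite list of (coefficient, point) pairs. *)
Definition comb (X : Type) := seq (R * X).

Definition comb_eval (X : Type) (k : X -> X -> R) (u : comb X) (x : X) : R :=
  \sum_(p <- u) p.1 * k p.2 x.

Definition comb_norm2 (X : Type) (k : X -> X -> R) (u : comb X) : R :=
  \sum_(p <- u) \sum_(q <- u) p.1 * q.1 * k p.2 q.2.

Definition comb_sub (X : Type) (u v : comb X) : comb X :=
  u ++ [seq (- p.1, p.2) | p <- v].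

Definition RKHS (X : Type) (k : X -> X -> R) : set (X -> R) :=
  [set f | exists u : nat -> comb X,
     (forall e : R, 0 < e -> exists N : nat, forall m n : nat,
        (N <= m)%N -> (N <= n)%N -> comb_norm2 k (comb_sub (u m) (u n)) < e)
     /\ (forall x : X, (fun n => comb_eval k (u n) x) @ \oo --> f x)].

End Defs.

(* Main.v *)
Require Import Defs.
From mathcomp Require Import all_boot all_order all_algebra.
From mathcomp Require Import all_classical all_reals all_analysis.
From mathcomp Require Import ring lra.
Set Implicit Arguments. Unset Strict Implicit. Unset Printing Implicit Defensive.
Import Order.TTheory GRing.Theory Num.Theory.
Import numFieldNormedType.Exports.
Local Open Scope ring_scope.
Local Open Scope classical_set_scope.

(** If [C k2 - k1] is positive semidefinite for some [C], then the RKHS of [k1]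
    is contained in that of [k2]. Write [f <= g] when [g - f] maps positive
    semidefinite kernels with values in the unit interval to positive
    semidefinite kernels; this order is compatible with sums, products, limits
    and, by differentiating along [r |-> r K], with primitives. With
    [phi v = 1 - sqrt (1 - v)], both kernels are equivalent to [1 + phi] at
    [v = <x, z>].
    - Laplace: the kernel is [exp (- c) exp (c phi)], and [phi ^ 2 = 2 phi - v]
      gives [phi ^ n <= 2 ^ (n - 1) phi], hence [1 + c phi <= exp (c phi)
      <= 1 + C phi].
    - NTK with two layers: up to constants it is
      [v + (2 v theta - chi + beta ^ 2 theta) / pi] with [theta = asin v] and
      [chi = 1 - cos theta]. One has [theta <= 4 phi] and [v phi <= 4 phi],
      and conversely [chi <= v theta] and [2 phi <= v theta + theta]; the
      summand [beta ^ 2 theta] is where [beta > 0] matters.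
    For deeper networks the factor [(pi - acos _) / pi] is at least [1 / 2] in
    this order, so that [Theta (h + 1) >= Theta h / 2]. *)

(** * Discriminants of nonnegative quadratics, and limits of finite sums *)

Lemma quadratic_discriminant (R : realType) (a b c : R) :
  (forall s, 0 <= s ^+ 2 * a + 2 * s * b + c) -> b ^+ 2 <= a * c.
Proof.
move=> H; have [a0|a0] := eqVneq a 0.
  have [->|b0] := eqVneq b 0; first by rewrite a0 mul0r expr0n.
  (* With [a = 0] the form is affine in [s]; it takes the value [-1] here. *)
  have := H (- (c + 1) / (2 * b)).
  have -> : (- (c + 1) / (2 * b)) ^+ 2 * a + 2 * (- (c + 1) / (2 * b)) * b + c
            = -1 by rewrite a0; field.
  by rewrite ler0N1.
have ap : 0 < a.
  rewrite lt0r a0 /= leNgt; apply/negP => an.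
  have := H 0; rewrite expr0n /= mul0r mulr0 mul0r !add0r => c0.
  (* For [a < 0] this [s] is so large that [s * a + 2 * b <= -1 - c]; as [s >= 1] and [c >= 0], the
     form is then at most [-1]. *)
  move: (H ((2 * `|b| + c + 1) / - a + 1)).
  set s := (_ / - a + 1) => Hs.
  have s1 : 1 <= s.
    by rewrite lerDr divr_ge0 ?oppr_ge0 ?(ltW an)//; have := normr_ge0 b; lra.
  have sa : s * - a = 2 * `|b| + c + 1 - a by rewrite /s; field.
  have : s * (s * a + 2 * b) <= s * (-1 - c).
    apply: ler_wpM2l; first by lra.
    by have := ler_norm b; lra.
  by nra.
(* The minimum of the quadratic. *)
have := H (- b / a).
have -> : (- b / a) ^+ 2 * a + 2 * (- b / a) * b + c = c - b ^+ 2 / a by field.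
by rewrite subr_ge0 ler_pdivrMr// mulrC.
Qed.

Lemma cvg_sum_seq (R : realType) (I : Type) (r : seq I) (F : I -> nat -> R) (a : I -> R) :
  (forall i, F i n @[n --> \oo] --> a i) ->
  (\sum_(i <- r) F i n) @[n --> \oo] --> \sum_(i <- r) a i.
Proof.
move=> Fa; elim: r => [|i r IH].
  by rewrite big_nil; under eq_fun do rewrite big_nil; exact: cvg_cst.
by rewrite big_cons; under eq_fun do rewrite big_cons; exact: cvgD.
Qed.

(** * Positive semidefinite kernels, up to the Schur product theorem *)

Definition comb_dot (R : realType) (X : Type) (K : X -> X -> R) (u v : comb R X) : R :=
  \sum_(p <- u) \sum_(q <- v) p.1 * q.1 * K p.2 q.2.

Definition comb_scale (R : realType) (X : Type) (a : R) (u : comb R X) : comb R X :=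
  [seq (a * p.1, p.2) | p <- u].

(** Symmetry is required separately, since a real quadratic form sees only the symmetric part of
    [K]. *)
Definition psd (R : realType) (X : Type) (K : X -> X -> R) : Prop :=
  (forall x y, K x y = K y x) /\ forall u : comb R X, 0 <= comb_norm2 K u.

Section PsdKernels.
Context {R : realType} {X : Type}.
Implicit Types (K L : X -> X -> R) (u v w : comb R X).

Lemma comb_norm2_dot K u : comb_norm2 K u = comb_dot K u u.
Proof. by []. Qed.

Lemma comb_dot_catl K u v w :
  comb_dot K (u ++ v) w = comb_dot K u w + comb_dot K v w.
Proof. exact: big_cat. Qed.

Lemma comb_dot_catr K u v w :
  comb_dot K w (u ++ v) = comb_dot K w u + comb_dot K w v.
Proof.
rewrite /comb_dot -big_split /=; apply: eq_bigr => p _; exact: big_cat.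
Qed.

Lemma comb_dotZl K a u w : comb_dot K (comb_scale a u) w = a * comb_dot K u w.
Proof.
rewrite /comb_dot big_map mulr_sumr; apply: eq_bigr => p _ /=.
by rewrite mulr_sumr; apply: eq_bigr => q _; rewrite !mulrA.
Qed.

Lemma comb_dotZr K a u w : comb_dot K w (comb_scale a u) = a * comb_dot K w u.
Proof.
rewrite /comb_dot mulr_sumr; apply: eq_bigr => p _ /=.
rewrite big_map mulr_sumr; apply: eq_bigr => q _ /=; ring.
Qed.

Lemma comb_dotC K u v : (forall x y, K x y = K y x) ->
  comb_dot K u v = comb_dot K v u.
Proof.
move=> Ks; rewrite /comb_dot exchange_big /=.
by apply: eq_bigr => p _; apply: eq_bigr => q _; rewrite Ks; ring.
Qed.

Lemma comb_subE u v : comb_sub u v = u ++ comb_scale (-1) v.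
Proof.
by congr (_ ++ _); apply: eq_map => p; rewrite mulN1r.
Qed.

Lemma comb_dot_eval K u v :
  comb_dot K u v = \sum_(q <- v) q.1 * comb_eval K u q.2.
Proof.
rewrite /comb_dot exchange_big /=; apply: eq_bigr => q _.
rewrite mulr_sumr; apply: eq_bigr => p _; ring.
Qed.

Lemma comb_norm2_scale_cat K s u v : psd K ->
  comb_norm2 K (comb_scale s u ++ v) =
  s ^+ 2 * comb_norm2 K u + 2 * s * comb_dot K u v + comb_norm2 K v.
Proof.
move=> [Ks _]; rewrite !comb_norm2_dot !comb_dot_catl !comb_dot_catr.
by rewrite !comb_dotZl !comb_dotZr (comb_dotC v u Ks); ring.
Qed.

Lemma psd_cauchy_schwarz K u v : psd K ->
  comb_dot K u v ^+ 2 <= comb_norm2 K u * comb_norm2 K v.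
Proof.
move=> KP; apply: quadratic_discriminant => s.
by rewrite -comb_norm2_scale_cat//; apply: KP.2.
Qed.

Lemma comb_dot1 K x y : comb_dot K [:: (1, x)] [:: (1, y)] = K x y.
Proof. by rewrite /comb_dot !big_seq1 /= !mul1r. Qed.

Lemma psd_diag_ge0 K x : psd K -> 0 <= K x x.
Proof. by case=> _ /(_ [:: (1, x)]); rewrite comb_norm2_dot comb_dot1. Qed.

Lemma psd_sqr_le K x y : psd K -> K x y ^+ 2 <= K x x * K y y.
Proof.
by move=> /(psd_cauchy_schwarz [:: (1, x)] [:: (1, y)]);
  rewrite !comb_norm2_dot !comb_dot1.
Qed.

Lemma psd_norm_le1 K : psd K -> (forall x, K x x = 1) ->
  forall x y, `|K x y| <= 1.
Proof.
move=> KP K1 x y; have := psd_sqr_le x y KP; rewrite !K1 mulr1.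
by rewrite -[X in _ <= X](expr1n _ 2) -real_normK ?num_real// ler_pXn2r ?nnegrE.
Qed.

Lemma eq_psd K L : (forall x y, K x y = L x y) -> psd K -> psd L.
Proof. by move=> KL; have -> : L = K by apply/funext => x; apply/funext => y. Qed.

Lemma psdD K L : psd K -> psd L -> psd (fun x y => K x y + L x y).
Proof.
move=> [Ks KP] [Ls LP]; split=> [x y|u]; first by rewrite Ks Ls.
have -> : comb_norm2 (fun x y => K x y + L x y) u = comb_norm2 K u + comb_norm2 L u.
  rewrite /comb_norm2 -big_split /=; apply: eq_bigr => p _.
  by rewrite -big_split /=; apply: eq_bigr => q _; rewrite mulrDr.
by rewrite addr_ge0.
Qed.

Lemma psdZ a K : 0 <= a -> psd K -> psd (fun x y => a * K x y).
Proof.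
move=> a0 [Ks KP]; split=> [x y|u]; first by rewrite Ks.
have -> : comb_norm2 (fun x y => a * K x y) u = a * comb_norm2 K u.
  rewrite /comb_norm2 mulr_sumr; apply: eq_bigr => p _.
  by rewrite mulr_sumr; apply: eq_bigr => q _; ring.
by rewrite mulr_ge0.
Qed.

Lemma psd_rank1 (g : X -> R) : psd (fun x y => g x * g y).
Proof.
split=> [x y|u]; first by rewrite mulrC.
have -> : comb_norm2 (fun x y => g x * g y) u = (\sum_(p <- u) p.1 * g p.2) ^+ 2.
  rewrite /comb_norm2 expr2 mulr_suml; apply: eq_bigr => p _.
  by rewrite mulr_sumr; apply: eq_bigr => q _; ring.
exact: sqr_ge0.
Qed.

Lemma psd_cst (a : R) : 0 <= a -> psd (fun _ _ : X => a).
Proof.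
by move=> a0; apply: eq_psd (psdZ a0 (psd_rank1 (fun=> 1))) => x y; ring.
Qed.

Lemma psd_lim (Kn : nat -> X -> X -> R) K : (forall n, psd (Kn n)) ->
  (forall x y, Kn n x y @[n --> \oo] --> K x y) -> psd K.
Proof.
move=> KnP KnK; split=> [x y|u].
  have E : (fun n => Kn n y x) = (fun n => Kn n x y).
    by apply/funext => n; rewrite (KnP n).1.
  have := KnK y x; rewrite E => Kyx.
  by rewrite -(cvg_lim _ (KnK x y))// -(cvg_lim _ Kyx).
have Ku : comb_norm2 (Kn n) u @[n --> \oo] --> comb_norm2 K u.
  rewrite /comb_norm2; apply: cvg_sum_seq => p; apply: cvg_sum_seq => q.
  exact: cvgMl_tmp.
rewrite -(cvg_lim _ Ku)//; apply: limr_ge; first by apply/cvg_ex; eexists; exact: Ku.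
by apply: nearW => n; apply: (KnP n).2.
Qed.

(** This is the Gram kernel after projecting orthogonally to the vector at [p]. Its nonnegativity is
    Cauchy-Schwarz against the one-point combination at [p]. *)
Lemma psd_schur_complement K p : psd K -> 0 < K p p ->
  psd (fun x y => K x y - K x p * K y p / K p p).
Proof.
move=> KP Kp; split=> [x y|u]; first by rewrite (KP.1 x y); ring.
set B := comb_dot K [:: (1, p)] u.
have -> : comb_norm2 (fun x y => K x y - K x p * K y p / K p p) u
          = comb_norm2 K u - B ^+ 2 / K p p.
  have -> : B = \sum_(q <- u) q.1 * K q.2 p.
    by rewrite /B /comb_dot big_seq1 /=; apply: eq_bigr => q _; rewrite mul1r (KP.1 p).
  rewrite /comb_norm2 expr2 mulr_suml mulr_suml -sumrB; apply: eq_bigr => i _.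
  rewrite mulr_sumr mulr_suml -sumrB; apply: eq_bigr => j _; ring.
rewrite subr_ge0 ler_pdivrMr// mulrC.
by have := psd_cauchy_schwarz [:: (1, p)] u KP; rewrite [X in _ <= X * _]comb_dot1.
Qed.

Lemma comb_norm2_cons0 K a p u : (forall x, K p x = 0) -> (forall x, K x p = 0) ->
  comb_norm2 K ((a, p) :: u) = comb_norm2 K u.
Proof.
move=> Kp0 K0p; rewrite /comb_norm2 big_cons /= big1 ?add0r => [|q _]; last first.
  by rewrite Kp0 mulr0.
by apply: eq_bigr => q _; rewrite big_cons K0p mulr0 add0r.
Qed.

(* Schur product theorem: splitting off the rank-one part of K at the first
   point leaves a Schur complement vanishing there. *)
Lemma psdM K L : psd K -> psd L -> psd (fun x y => K x y * L x y).
Proof.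
move=> KP LP; split=> [x y|u]; first by rewrite KP.1 LP.1.
(* [K] is generalized because the induction hypothesis is applied to its Schur complement. *)
elim: u K KP => [|[a p] u IH] K KP; first by rewrite /comb_norm2 big_nil.
(* If [K p p = 0], Cauchy-Schwarz annihilates the whole row of [p], which drops out of the sum. *)
have [Kp0|Kp0] := eqVneq (K p p) 0.
  have Kpx x : K p x = 0.
    apply/eqP; rewrite -sqrf_eq0 eq_le sqr_ge0 andbT.
    by have := psd_sqr_le p x KP; rewrite Kp0 mul0r.
  rewrite comb_norm2_cons0 ?IH // => x; first by rewrite Kpx mul0r.
  by rewrite KP.1 Kpx mul0r.
have Kp : 0 < K p p by rewrite lt0r Kp0 psd_diag_ge0.
pose K' x y := K x y - K x p * K y p / K p p.
have K'P : psd K' by exact: psd_schur_complement.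
(* Multiplying the rank-one part of [K] by [L] amounts to reweighting each coefficient by [K q p],
   which leaves a value of the quadratic form of [L]. *)
have KE w : comb_norm2 (fun x y => K x y * L x y) w =
    comb_norm2 (fun x y => K' x y * L x y) w +
    comb_norm2 L [seq (q.1 * K q.2 p, q.2) | q <- w] / K p p.
  rewrite /comb_norm2 big_map mulr_suml -big_split /=; apply: eq_bigr => i _.
  rewrite big_map mulr_suml -big_split /=; apply: eq_bigr => j _.
  by rewrite /K'; field.
rewrite KE addr_ge0//; last by rewrite divr_ge0 ?(ltW Kp)//; exact: LP.2.
have K'p x : K' x p = 0 by rewrite /K'; field.
by rewrite comb_norm2_cons0 ?IH // => x; [rewrite K'P.1 K'p mul0r | rewrite K'p mul0r].
Qed.

End PsdKernels.

(** * Comparison of reproducing kernel Hilbert spaces *)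

(* A function in the RKHS of [k1] induces a functional on combinations that is
   bounded for [k1], hence for [k2]; minimising the square norm minus twice this
   functional produces the approximating sequence (Riesz representation). *)
Lemma RKHS_subset (R : realType) (X : Type) (k1 k2 : X -> X -> R) (C : R) :
  0 <= C -> psd k1 -> psd k2 -> psd (fun x y => C * k2 x y - k1 x y) ->
  RKHS k1 `<=` RKHS k2.
Proof.
move=> C0 k1P k2P kP f [u [uC uf]].
pose l (v : comb R X) := \sum_(q <- v) q.1 * f q.2.
have lcvg v : comb_dot k1 (u n) v @[n --> \oo] --> l v.
  rewrite (_ : (fun n => _) = fun n => \sum_(q <- v) q.1 * comb_eval k1 (u n) q.2).
    by apply: cvg_sum_seq => q; apply: cvgMl_tmp; exact: uf.
  by apply/funext => n; rewrite comb_dot_eval.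
have [M [M0 lM]] : exists M, 0 <= M /\ forall v, l v ^+ 2 <= M * comb_norm2 k2 v.
  have [N uN] := uC 1 ltr01.
  pose M := 2 + 2 * comb_norm2 k1 (u N).
  have M0 : 0 <= M by have := k1P.2 (u N); rewrite /M; lra.
  have uM n : (N <= n)%N -> comb_norm2 k1 (u n) <= M.
    move=> Nn; have := uN n N Nn (leqnn N).
    rewrite comb_subE.
    (* [||u_n - 2 u_N||^2 = 2 ||u_n - u_N||^2 + 2 ||u_N||^2 - ||u_n||^2], which explains the choice
       of [M]. *)
    have := k1P.2 (comb_scale (-2) (u N) ++ u n).
    rewrite comb_norm2_scale_cat//.
    rewrite [comb_norm2 _ (u n ++ _)]comb_norm2_dot !comb_dot_catl !comb_dot_catr.
    rewrite !comb_dotZl !comb_dotZr (comb_dotC (u n) (u N) k1P.1) -!comb_norm2_dot /M.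
    lra.
  exists (M * C); split; first by rewrite mulr_ge0.
  move=> v.
  have k12 : comb_norm2 k1 v <= C * comb_norm2 k2 v.
    have := kP.2 v.
    have -> : comb_norm2 (fun x y => C * k2 x y - k1 x y) v =
              C * comb_norm2 k2 v - comb_norm2 k1 v.
      rewrite /comb_norm2 mulr_sumr -sumrB; apply: eq_bigr => p _.
      rewrite mulr_sumr -sumrB; apply: eq_bigr => q _; ring.
    by rewrite subr_ge0.
  have lv2 : comb_dot k1 (u n) v ^+ 2 @[n --> \oo] --> l v ^+ 2.
    by rewrite expr2; under eq_fun do rewrite expr2; apply: cvgM.
  rewrite -(cvg_lim _ lv2)//; apply: limr_le; first by apply/cvg_ex; eexists; exact: lv2.
  exists N => // n /= Nn.
  apply: le_trans (psd_cauchy_schwarz _ _ k1P) _.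
  apply: (@le_trans _ _ (M * comb_norm2 k1 v)).
    by rewrite ler_wpM2r ?uM//; exact: k1P.2.
  by rewrite -mulrA ler_wpM2l.
have l_cat v w : l (v ++ w) = l v + l w by exact: big_cat.
have lZ a v : l (comb_scale a v) = a * l v.
  by rewrite /l big_map mulr_sumr; apply: eq_bigr => q _; rewrite mulrA.
(* If [r] represents [l] in the completion for [k2], then [J v = ||v - r||^2 - ||r||^2]. *)
pose J v := comb_norm2 k2 v - 2 * l v.
pose E := [set J v | v in [set: comb R X]].
have Elb : lbound E (- M).
  move=> _ [v _ <-]; rewrite /J.
  suff : 0 <= comb_norm2 k2 v + 2 * (- l v) + M by lra.
  have k2v := k2P.2 v; have lv := lM v.
  (* Arithmetic-geometric mean inequality: [4 M ||v||^2 <= (||v||^2 + M)^2]. *)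
  have : (2 * l v) ^+ 2 <= (comb_norm2 k2 v + M) ^+ 2.
    have -> : (2 * l v) ^+ 2 = 4 * l v ^+ 2 by ring.
    have -> : (comb_norm2 k2 v + M) ^+ 2 =
      (comb_norm2 k2 v - M) ^+ 2 + 4 * (M * comb_norm2 k2 v) by ring.
    by have := sqr_ge0 (comb_norm2 k2 v - M); lra.
  rewrite -[X in X <= _]real_normK ?num_real// ler_pXn2r ?nnegrE ?normr_ge0 //;
    last exact: addr_ge0.
  by have := ler_norm (2 * l v); lra.
have Einf : has_inf E.
  by split; [exists (J [::]), [::] | exists (- M)].
have JE v : inf E <= J v by apply: ge_inf; [exists (- M) | exists v].
have [v vE] : {v : nat -> comb R X & forall n, J (v n) < inf E + n.+1%:R^-1}.
  apply: (@choice _ _ (fun n v => J v < inf E + n.+1%:R^-1)) => n.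
  have n0 : 0 < n.+1%:R^-1 :> R by rewrite invr_gt0.
  by have [_ [v _ <-] ?] := inf_adherent n0 Einf; exists v.
exists v; split.
  move=> e e0.
  have /cvgrPdist_lt/(_ (e / 4)) := @cvg_harmonic R.
  case; first by rewrite divr_gt0.
  move=> N _ HN; exists N => m n Nm Nn.
  have Hm := HN m Nm; have Hn := HN n Nn.
  (* Parallelogram law: [J] at the midpoint is the mean of [J (v m)] and [J (v n)] minus
     [||v m - v n||^2 / 4], and it is at least [inf E]. *)
  have := JE (comb_scale (1/2) (v m ++ v n)).
  have := vE m; have := vE n.
  rewrite comb_subE /J lZ l_cat !comb_norm2_dot.
  rewrite !comb_dotZl !comb_dotZr !comb_dot_catl !comb_dot_catr !comb_dotZl !comb_dotZr.
  rewrite (comb_dotC (v n) (v m) k2P.1).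
  move: Hm Hn; rewrite /= !sub0r !normrN !ger0_norm ?invr_ge0//.
  move: (comb_dot _ _ _) (comb_dot _ _ _) (comb_dot _ _ _) (l _) (l _) (inf E).
  move: (n.+1%:R^-1) (m.+1%:R^-1) => *; lra.
move=> x.
pose D n := comb_eval k2 (v n) x - f x.
pose k := k2 x x.
have k0 : 0 <= k by exact: psd_diag_ge0.
have DE n : D n ^+ 2 <= (k + 1) * n.+1%:R^-1.
  (* Adding [t] times the point [x] changes [J] by [t ^ 2 k + 2 t D]. The best [t] is [- D / k]; the
     denominator [k + 1] also covers [k = 0]. *)
  have := JE (comb_scale (- D n / (k + 1)) [:: (1, x)] ++ v n); have := vE n.
  rewrite /J l_cat lZ comb_norm2_scale_cat// [comb_norm2 _ [:: _]]comb_dot1 -/k.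
  rewrite (comb_dotC _ _ k2P.1) comb_dot_eval big_seq1 /l big_seq1 -/(l _) !mul1r /=.
  have -> : comb_eval k2 (v n) x = D n + f x by rewrite /D; ring.
  set N := comb_norm2 _ _; set h := n.+1%:R^-1; set d := D n.
  move=> H1 H2.
  have : (d / (k + 1)) ^+ 2 * (k + 2) <= h.
    have -> : (d / (k + 1)) ^+ 2 * (k + 2) =
       - ((- d / (k + 1)) ^+ 2 * k + 2 * (- d / (k + 1)) * d).
      by field; lra.
    lra.
  have -> : d = (d / (k + 1)) * (k + 1) by field; lra.
  rewrite mulfK; last by lra.
  move=> H; rewrite exprMn.
  have := sqr_ge0 (d / (k + 1)).
  set y := _ ^+ 2 in H *; nra.
have DC : D n @[n --> \oo] --> 0.
  apply/cvgr0Pnorm_le => e e0.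
  have /cvgrPdist_lt/(_ (e ^+ 2 / (k + 1))) := @cvg_harmonic R.
  case; first by rewrite divr_gt0 ?exprn_gt0//; lra.
  move=> N _ HN; exists N => // n /= Nn.
  have := HN n Nn; rewrite /= sub0r normrN ger0_norm ?invr_ge0// => Hn.
  rewrite -(@ler_pXn2r _ 2) ?nnegrE ?(ltW e0)// real_normK ?num_real//.
  apply: le_trans (DE n) _; rewrite mulrC -ler_pdivlMr; last by lra.
  exact: ltW.
have -> : (fun n => comb_eval k2 (v n) x) = (fun n => D n + f x).
  by apply/funext => n; rewrite /D subrK.
by rewrite -[X in _ --> X]add0r; apply: cvgD => //; exact: cvg_cst.
Qed.

(** * Functions preserving positive semidefiniteness *)

(* By Schoenberg's theorem these are the functions with nonnegative Taylor
   coefficients. *)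
Definition psd_preserving (R : realType) (f : R -> R) : Prop :=
  forall (X : Type) (K : X -> X -> R), psd K -> (forall x y, `|K x y| < 1) ->
  psd (fun x y => f (K x y)).

Section PsdPreserving.
Context {R : realType}.
Implicit Types (f g : R -> R).

Lemma eq_psd_preserving f g : (forall v, `|v| < 1 -> f v = g v) ->
  psd_preserving f -> psd_preserving g.
Proof. by move=> fg fP X K KP K1; apply: eq_psd (fP X K KP K1) => x y; exact: fg. Qed.

Lemma psd_preserving_id : psd_preserving (fun v : R => v).
Proof. by move=> X K KP K1. Qed.

Lemma psd_preserving_cst (a : R) : 0 <= a -> psd_preserving (fun=> a).
Proof. by move=> a0 X K KP K1; exact: psd_cst. Qed.

Lemma psd_preservingD f g : psd_preserving f -> psd_preserving g ->
  psd_preserving (fun v => f v + g v).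
Proof. by move=> fP gP X K KP K1; apply: psdD; [exact: fP | exact: gP]. Qed.

Lemma psd_preservingM f g : psd_preserving f -> psd_preserving g ->
  psd_preserving (fun v => f v * g v).
Proof. by move=> fP gP X K KP K1; apply: psdM; [exact: fP | exact: gP]. Qed.

Lemma psd_preservingZ a f : 0 <= a -> psd_preserving f ->
  psd_preserving (fun v => a * f v).
Proof. by move=> a0 fP X K KP K1; apply: psdZ => //; exact: fP. Qed.

Lemma psd_preservingX f n : psd_preserving f -> psd_preserving (fun v => f v ^+ n).
Proof.
move=> fP; elim: n => [|n IH].
  by apply: eq_psd_preserving (psd_preserving_cst ler01) => v _; rewrite expr0.
by apply: eq_psd_preserving (psd_preservingM fP IH) => v _; rewrite exprS.
Qed.

Lemma psd_preserving_sum n (F : nat -> R -> R) : (forall i, psd_preserving (F i)) ->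
  psd_preserving (fun v => \sum_(0 <= i < n) F i v).
Proof.
move=> FP; elim: n => [|n IH].
  by apply: eq_psd_preserving (psd_preserving_cst (lexx 0)) => v _; rewrite big_geq.
by apply: eq_psd_preserving (psd_preservingD IH (FP n)) => v _; rewrite big_nat_recr.
Qed.

Lemma psd_preserving_lim (fn : nat -> R -> R) f : (forall n, psd_preserving (fn n)) ->
  (forall v, `|v| < 1 -> fn n v @[n --> \oo] --> f v) -> psd_preserving f.
Proof.
move=> fnP fnf X K KP K1.
by apply: (@psd_lim _ _ (fun n x y => fn n (K x y))) => [n|x y]; [exact: fnP|exact: fnf].
Qed.

Lemma psd_preserving_comp f g : psd_preserving f -> psd_preserving g ->
  (forall v, `|v| < 1 -> `|g v| < 1) -> psd_preserving (fun v => f (g v)).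
Proof.
move=> fP gP g1 X K KP K1.
by apply: (fP X (fun x y => g (K x y))) => [|x y]; [exact: gP | exact: g1].
Qed.

(** The partial sums of the geometric series are polynomials in [f] with nonnegative
    coefficients. *)
Lemma psd_preserving_geometric f : psd_preserving f ->
  (forall v, `|v| < 1 -> `|f v| < 1) -> psd_preserving (fun v => (1 - f v)^-1).
Proof.
move=> fP f1.
apply: (@psd_preserving_lim (fun n v => \sum_(0 <= i < n) f v ^+ i)) => [n|v v1].
  by apply: psd_preserving_sum => i; exact: psd_preservingX.
have := cvg_geometric_series (a := 1) (f1 v v1); rewrite mul1r.
rewrite (_ : series _ = fun n => \sum_(0 <= i < n) f v ^+ i)//.
by apply/funext => n /=; apply: eq_bigr => i _ /=; rewrite mul1r.
Qed.

Lemma is_derive1_sum_seq (I : Type) (r : seq I) (F dF : I -> R -> R) (x : R) :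
  (forall i, is_derive x 1 (F i) (dF i x)) ->
  is_derive x 1 (fun y => \sum_(i <- r) F i y) (\sum_(i <- r) dF i x).
Proof.
move=> FD; elim: r => [|i r IH].
  rewrite big_nil (_ : (fun y => _) = cst 0); first exact: is_derive_cst.
  by apply/funext => y; rewrite big_nil.
rewrite big_cons (_ : (fun y => _) = F i + (fun y => \sum_(j <- r) F j y)).
  exact: is_deriveD.
by apply/funext => y; rewrite big_cons.
Qed.

(* For fixed coefficients, [r |-> sum a_i a_j f (r K_ij)] is nondecreasing on
   [0, 1], since its derivative involves the kernel [K * f' (r K)]. *)
Lemma psd_preserving_primitive f f' : psd_preserving f' -> 0 <= f 0 ->
  (forall v : R, `|v| < 1 -> is_derive v 1 f (f' v)) -> psd_preserving f.
Proof.
move=> f'P f0 fD X K KP K1; split=> [x y|u]; first by rewrite KP.1.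
have rK1 (r : R) x y : 0 <= r <= 1 -> `|r * K x y| < 1.
  move=> /andP[r0 r1]; rewrite normrM (ger0_norm r0).
  by apply: le_lt_trans (K1 x y); rewrite ler_piMl.
pose F r := comb_norm2 (fun x y => f (r * K x y)) u.
pose F' r := comb_norm2 (fun x y => K x y * f' (r * K x y)) u.
have FD (r : R) : 0 <= r <= 1 -> is_derive r 1 F (F' r).
  move=> r01; rewrite /F /F' /comb_norm2.
  apply: (@is_derive1_sum_seq _ u _ (fun p r => \sum_(q <- u)
    p.1 * q.1 * (K p.2 q.2 * f' (r * K p.2 q.2)))) => p.
  apply: (@is_derive1_sum_seq _ u _ (fun q r =>
    p.1 * q.1 * (K p.2 q.2 * f' (r * K p.2 q.2)))) => q.
  have := fD _ (rK1 r p.2 q.2 r01); set k := K p.2 q.2 => fDk.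
  have kD : is_derive r 1 (fun s : R => s * k) k.
    have := is_deriveZ k (is_derive_id r 1).
    rewrite (_ : k \*: id = fun s => s * k) ?[k *: 1]mulr1//.
    by apply/funext => s; exact: mulrC.
  have := is_deriveZ (p.1 * q.1) (@is_derive1_comp _ f (fun s => s * k) r _ _ fDk kD).
  rewrite [X in is_derive _ _ _ X](_ : _ = p.1 * q.1 * (k * f' (r * k)))//.
  by congr (_ * _); exact: mulrC.
have Fc : {within `[0, 1], continuous F}.
  apply: derivable_within_continuous => r; rewrite in_itv /= => r01.
  by have := FD r r01; case.
have FDo (r : R) : r \in `]0, 1[%R -> is_derive r 1 F (F' r).
  by rewrite in_itv /= => /andP[r0 r1]; apply: FD; rewrite !ltW.
have [s] := MVT ltr01 FDo Fc.
rewrite in_itv /= subr0 mulr1 => /andP[s0 s1] FE.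
have -> : comb_norm2 (fun x y => f (K x y)) u = F 1.
  by rewrite /F /comb_norm2; apply: eq_bigr => p _; apply: eq_bigr => q _; rewrite mul1r.
have F0 : 0 <= F 0.
  by apply: (eq_psd _ (@psd_cst R X _ f0)).2 => x y; rewrite mul0r.
have : 0 <= F' s.
  apply: (@psdM _ _ K (fun x y => f' (s * K x y)) KP _).2.
  apply: f'P (psdZ (ltW s0) KP) _ => x y.
  by apply: rK1; rewrite !ltW.
by move: FE => /eqP; rewrite subr_eq => /eqP ->; move=> ?; rewrite addr_ge0.
Qed.

End PsdPreserving.

(** * The square root function [phi] and its even and odd parts *)

Section SquareRoot.
Context {R : realType}.
Implicit Types v : R.

Definition phi v : R := 1 - Num.sqrt (1 - v).

(** Fixed-point iteration for [phi = (v + phi ^ 2) / 2]; every iterate is a polynomial in [v] with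
    nonnegative coefficients. *)
Definition sqrt_iter n v : R := iter n (fun x => (v + x ^+ 2) / 2) 0.

Lemma phi_sqr v : v <= 1 -> phi v ^+ 2 = 2 * phi v - v.
Proof.
move=> v1; rewrite /phi.
have := @sqr_sqrtr _ (1 - v); rewrite subr_ge0 => /(_ v1).
by set s := Num.sqrt _ => s2; rewrite sqrrB s2; ring.
Qed.

Lemma normr_lt1 v : `|v| < 1 -> -1 < v < 1.
Proof. by rewrite ltr_norml. Qed.

Lemma phi_norm v : `|v| < 1 -> `|phi v| < 1.
Proof.
move=> /normr_lt1 /andP[v1 v2]; rewrite /phi.
have s0 : 0 < Num.sqrt (1 - v) by rewrite sqrtr_gt0; lra.
have := @sqr_sqrtr _ (1 - v); move: s0; set s := Num.sqrt _ => s0 /(_ _) s2.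
have {}s2 : s ^+ 2 = 1 - v by apply: s2; lra.
by rewrite ltr_norml; apply/andP; split; nra.
Qed.

Lemma sqrt_iter_norm n v : `|v| <= 1 -> `|sqrt_iter n v| <= `|v|.
Proof.
move=> v1; elim: n => [|n IH]; first by rewrite normr0.
rewrite /sqrt_iter iterS -/(sqrt_iter n v) normrM (ger0_norm (_ : 0 <= 2^-1))//.
have := ler_normD v (sqrt_iter n v ^+ 2); rewrite normrX.
have := normr_ge0 (sqrt_iter n v); nra.
Qed.

(** The error is multiplied at each step by [(phi v + sqrt_iter n v) / 2], of modulus at most
    [q = (1 + |v|) / 2 < 1]. *)
Lemma cvg_sqrt_iter v : `|v| < 1 -> sqrt_iter n v @[n --> \oo] --> phi v.
Proof.
move=> v1; pose q := (1 + `|v|) / 2.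
have q0 : 0 <= q by rewrite /q; have := normr_ge0 v; lra.
have qb n : `|phi v - sqrt_iter n v| <= q ^+ n.
  elim: n => [|n IH]; first by rewrite expr0 subr0 ltW// phi_norm.
  have -> : phi v - sqrt_iter n.+1 v =
      (phi v + sqrt_iter n v) / 2 * (phi v - sqrt_iter n v).
    rewrite /sqrt_iter iterS -/(sqrt_iter n v).
    have := @phi_sqr v; have /normr_lt1/andP[_ /ltW v1'] := v1; move=> /(_ v1') E.
    have {1}-> : phi v = (v + phi v ^+ 2) / 2 by rewrite E; field.
    by field.
  rewrite normrM exprS ler_pM// normrM (ger0_norm (_ : 0 <= 2^-1))// /q.
  have := ler_normD (phi v) (sqrt_iter n v).
  have := @sqrt_iter_norm n v (ltW v1); have := phi_norm v1; lra.
apply/cvgrPdist_le => e e0.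
have q1 : `|q| < 1 by rewrite ger0_norm// /q; lra.
have /cvgr0Pnorm_le/(_ e e0) := cvg_expr q1.
apply: filterS => n; rewrite normrX (ger0_norm q0); exact: le_trans.
Qed.

Lemma psd_preserving_sqrt_iter n : psd_preserving (sqrt_iter n).
Proof.
elim: n => [|n IH]; first exact: psd_preserving_cst.
have h0 : 0 <= 2^-1 :> R by [].
apply: eq_psd_preserving (psd_preservingZ h0 (psd_preservingD psd_preserving_id
  (psd_preservingX 2 IH))) => v _.
by rewrite /sqrt_iter iterS mulrC.
Qed.

Lemma psd_preserving_phi : psd_preserving phi.
Proof.
apply: (psd_preserving_lim psd_preserving_sqrt_iter) => v; exact: cvg_sqrt_iter.
Qed.

Definition chi v : R := 1 - Num.sqrt (1 - v ^+ 2).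

Lemma sqr_norm_lt1 v : `|v| < 1 -> `|v ^+ 2| < 1.
Proof. by move=> v1; rewrite normrX expr_lt1. Qed.

Lemma psd_preserving_chi : psd_preserving chi.
Proof.
exact: (psd_preserving_comp psd_preserving_phi
  (psd_preservingX 2 psd_preserving_id) sqr_norm_lt1).
Qed.

Lemma chi_norm v : `|v| < 1 -> `|chi v| < 1.
Proof. by move=> v1; exact: phi_norm (sqr_norm_lt1 v1). Qed.

Lemma chi_half_norm v : `|v| < 1 -> `|chi v / 2| < 1.
Proof.
by move=> /chi_norm; rewrite normrM (ger0_norm (_ : 0 <= 2^-1))//; lra.
Qed.

(* In terms of [theta = asin v]: [chi = 1 - cos theta],
   [phi_even = 1 - cos (theta / 2)], [phi_odd = sin (theta / 2)]. *)
Definition phi_even v : R := 1 - (Num.sqrt (1 + v) + Num.sqrt (1 - v)) / 2.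
Definition phi_odd v : R := (Num.sqrt (1 + v) - Num.sqrt (1 - v)) / 2.

Lemma phi_even_odd v : phi v = phi_even v + phi_odd v.
Proof. by rewrite /phi /phi_even /phi_odd; field. Qed.

Lemma sqrt_factors v : `|v| < 1 ->
  [/\ 0 < Num.sqrt (1 + v), 0 < Num.sqrt (1 - v),
      Num.sqrt (1 + v) ^+ 2 = 1 + v, Num.sqrt (1 - v) ^+ 2 = 1 - v &
      Num.sqrt (1 - v ^+ 2) = Num.sqrt (1 + v) * Num.sqrt (1 - v)].
Proof.
move=> /normr_lt1 /andP[v1 v2]; split.
- by rewrite sqrtr_gt0; lra.
- by rewrite sqrtr_gt0; lra.
- by rewrite sqr_sqrtr//; lra.
- by rewrite sqr_sqrtr//; lra.
- by rewrite -sqrtrM; [congr Num.sqrt; ring | lra].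
Qed.

(** Half-angle formula [cos (theta / 2) = sqrt ((1 + cos theta) / 2)], the radicand being
    [1 - chi / 2]. *)
Lemma phi_evenE v : `|v| < 1 -> phi_even v = phi (chi v / 2).
Proof.
move=> v1; rewrite /phi_even /phi /chi.
have [a0 b0 a2 b2 ->] := sqrt_factors v1.
move: a0 b0 a2 b2; set a := Num.sqrt (1 + v); set b := Num.sqrt (1 - v) => a0 b0 a2 b2.
have -> : 1 - (1 - a * b) / 2 = ((a + b) / 2) ^+ 2.
  have -> : ((a + b) / 2) ^+ 2 = (a ^+ 2 + b ^+ 2 + 2 * (a * b)) / 4 by field.
  by rewrite a2 b2; field.
by rewrite sqrtr_sqr ger0_norm// divr_ge0// addr_ge0// ltW.
Qed.

Lemma phi_even_norm v : `|v| < 1 -> `|phi_even v| < 1.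
Proof. by move=> v1; rewrite phi_evenE// phi_norm// chi_half_norm. Qed.

Lemma psd_preserving_chi_half : psd_preserving (fun v => chi v / 2).
Proof.
have h0 : 0 <= 2^-1 :> R by [].
by apply: eq_psd_preserving (psd_preservingZ h0 psd_preserving_chi) => v _; rewrite mulrC.
Qed.

Lemma psd_preserving_phi_even : psd_preserving phi_even.
Proof.
apply: eq_psd_preserving (psd_preserving_comp psd_preserving_phi
  psd_preserving_chi_half chi_half_norm) => v v1; by rewrite phi_evenE.
Qed.

(* [chi ^ 2 = 2 chi - v ^ 2] makes the bound [chi / 2] stable under the
   square root iteration started from [chi / 2]. *)
Lemma phi_even_le_chi : psd_preserving (fun v => chi v / 2 - phi_even v).
Proof.
apply: (@psd_preserving_lim _ (fun n v => chi v / 2 - sqrt_iter n (chi v / 2)))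
  => [n|v v1]; last first.
  apply: cvgB; first exact: cvg_cst.
  by rewrite phi_evenE//; exact: cvg_sqrt_iter (chi_half_norm v1).
elim: n => [|n IH].
  by apply: eq_psd_preserving psd_preserving_chi_half => v _; rewrite subr0.
have h0 : 0 <= 2^-1 :> R by [].
have h8 : 0 <= 8^-1 :> R by [].
have XP : psd_preserving (fun v => sqrt_iter n (chi v / 2)).
  exact: psd_preserving_comp (psd_preserving_sqrt_iter n)
    psd_preserving_chi_half chi_half_norm.
(* With [X] the current iterate, [chi / 2 - (chi / 2 + X ^ 2) / 2 = v ^ 2 / 8 + (chi / 2 - X) (chi /
   2 + X) / 2]. *)
apply: eq_psd_preserving (psd_preservingD
  (psd_preservingZ h8 (psd_preservingX 2 psd_preserving_id))
  (psd_preservingZ h0 (psd_preservingM IH (psd_preservingD psd_preserving_chi_half XP)))).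
move=> v v1; rewrite [in RHS]/sqrt_iter iterS -/(sqrt_iter n _).
have : chi v ^+ 2 = 2 * chi v - v ^+ 2.
  apply: phi_sqr; have /normr_lt1/andP[_] := sqr_norm_lt1 v1; exact: ltW.
set c := chi v; set X := sqrt_iter n _ => E.
have -> : v ^+ 2 = 2 * c - c ^+ 2 by rewrite E; ring.
by field.
Qed.

Lemma psd_preserving_inv_cos : psd_preserving (fun v => (Num.sqrt (1 - v ^+ 2))^-1).
Proof.
apply: eq_psd_preserving (psd_preserving_geometric psd_preserving_chi chi_norm) => v _.
by rewrite /chi; congr (_^-1); ring.
Qed.

(** [sin (theta / 2) = sin theta / (2 cos (theta / 2))], expanded as a geometric series in
    [phi_even]. *)
Lemma psd_preserving_phi_odd : psd_preserving phi_odd.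
Proof.
have h0 : 0 <= 2^-1 :> R by [].
apply: eq_psd_preserving (psd_preservingZ h0 (psd_preservingM psd_preserving_id
  (psd_preserving_geometric psd_preserving_phi_even phi_even_norm))) => v v1.
rewrite /phi_even /phi_odd; have [a0 b0 a2 b2 _] := sqrt_factors v1.
move: a0 b0 a2 b2; set a := Num.sqrt (1 + v); set b := Num.sqrt (1 - v) => a0 b0 a2 b2.
have -> : v = (a ^+ 2 - b ^+ 2) / 2 by rewrite a2 b2; field.
by field; rewrite gt_eqF//; lra.
Qed.

Lemma id_le_phi : psd_preserving (fun v => 2 * phi v - v).
Proof.
apply: eq_psd_preserving (psd_preservingX 2 psd_preserving_phi) => v v1.
by rewrite phi_sqr//; have /normr_lt1/andP[_ /ltW] := v1.
Qed.

(** The difference equals [2 v + phi ^ 3]. *)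
Lemma mul_phi_le_phi : psd_preserving (fun v => 4 * phi v - v * phi v).
Proof.
have h0 : 0 <= 2 :> R by [].
apply: eq_psd_preserving (psd_preservingD (psd_preservingZ h0 psd_preserving_id)
   (psd_preservingX 3 psd_preserving_phi)) => v v1.
have E : phi v ^+ 2 = 2 * phi v - v by apply: phi_sqr; have /normr_lt1/andP[_ /ltW] := v1.
by rewrite (exprS _ 2) E mulrBr mulrCA -expr2 E; ring.
Qed.

End SquareRoot.

(** * The arcsine, and the two-layer kernel as a function of the inner product *)

Section ArcSine.
Context {R : realType}.
Implicit Types v : R.

(* The arcsine, written with the [acos] of the kernel recursion. *)
Definition ang v : R := pi / 2 - acos v.

Lemma ang0 : ang 0 = 0.
Proof. by rewrite /ang acos0 subrr. Qed.

Lemma is_derive_ang v : `|v| < 1 -> is_derive v 1 ang (Num.sqrt (1 - v ^+ 2))^-1.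
Proof.
move=> /normr_lt1 v1.
have H := is_deriveB (is_derive_cst (pi / 2 : R) v 1) (is_derive1_acos v1).
by apply: (is_derive_eq H); rewrite sub0r opprK.
Qed.

Lemma is_derive_sqrt1B v : `|v| < 1 ->
  is_derive v 1 (fun w => Num.sqrt (1 - w)) (- (2 * Num.sqrt (1 - v))^-1).
Proof.
move=> /normr_lt1/andP[v1 v2].
have H := is_deriveB (is_derive_cst (1 : R) v 1) (is_derive_id v 1).
have p : 0 < 1 - v by rewrite subr_gt0.
have H2 := @is_derive1_comp R Num.sqrt (cst 1 - id) v _ _ (is_derive1_sqrt p) H.
by apply: (is_derive_eq H2); rewrite sub0r mulrN1.
Qed.

Lemma is_derive_sqrt1D v : `|v| < 1 ->
  is_derive v 1 (fun w => Num.sqrt (1 + w)) (2 * Num.sqrt (1 + v))^-1.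
Proof.
move=> /normr_lt1/andP[v1 v2].
have H := is_deriveD (is_derive_cst (1 : R) v 1) (is_derive_id v 1).
have p : 0 < 1 + v by lra.
have H2 := @is_derive1_comp R Num.sqrt (cst 1 + id) v _ _ (is_derive1_sqrt p) H.
by apply: (is_derive_eq H2); rewrite add0r mulr1.
Qed.

Lemma is_derive_sqrt1B_sqr v : `|v| < 1 ->
  is_derive v 1 (fun w => Num.sqrt (1 - w ^+ 2)) (- (v / Num.sqrt (1 - v ^+ 2))).
Proof.
move=> v1; have /normr_lt1/andP[_ v2] := sqr_norm_lt1 v1.
have H := is_deriveB (is_derive_cst (1 : R) v 1) (is_deriveX 2 (is_derive_id v 1)).
have p : 0 < 1 - v ^+ 2 by rewrite subr_gt0.
have H2 := @is_derive1_comp R Num.sqrt (cst 1 - id ^+ 2) v _ _ (is_derive1_sqrt p) H.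
apply: (is_derive_eq H2); rewrite sub0r /= [_ *: _]mulr1 expr1.
by field; rewrite sqrtr_eq0 -ltNge.
Qed.

Lemma psd_preserving_ang : psd_preserving ang.
Proof.
apply: (psd_preserving_primitive psd_preserving_inv_cos) is_derive_ang.
by rewrite ang0.
Qed.

(** With [cos theta = sqrt (1 - v ^ 2)], the derivative is [(2 sqrt (1 + v) - 1) / cos theta = 1 + 2
    (chi / 2 - phi_even + phi_odd) / cos theta]. *)
Lemma ang_le_phi : psd_preserving (fun v => 4 * phi v - ang v).
Proof.
have h2 : 0 <= 2 :> R by [].
have P := psd_preservingD (psd_preserving_cst (@ler01 R)) (psd_preservingZ h2
  (psd_preservingM (psd_preservingD phi_even_le_chi psd_preserving_phi_odd)
                   psd_preserving_inv_cos)).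
apply: (psd_preserving_primitive P).
  by rewrite ang0 /phi !subr0 sqrtr1; lra.
move=> v v1.
have H1 := is_deriveB (is_derive_cst (1 : R) v 1) (is_derive_sqrt1B v1).
have H := is_deriveB (is_deriveZ 4 H1) (is_derive_ang v1).
apply: (is_derive_eq H).
rewrite [4 *: _](_ : _ = 4 * (0 - - (2 * Num.sqrt (1 - v))^-1))// /chi /phi_even /phi_odd.
have [a0 b0 a2 b2 ->] := sqrt_factors v1.
move: a0 b0 a2 b2; set a := Num.sqrt (1 + v); set b := Num.sqrt (1 - v) => a0 b0 a2 b2.
by field; rewrite !gt_eqF.
Qed.

(** The derivative is [phi_even / cos theta]. *)
Lemma phi_odd_le_ang : psd_preserving (fun v => ang v - 2 * phi_odd v).
Proof.
have P := psd_preservingM (@psd_preserving_phi_even R) psd_preserving_inv_cos.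
apply: (psd_preserving_primitive P).
  by rewrite ang0 /phi_odd subr0 addr0; lra.
move=> v v1.
have H := is_deriveB (is_derive_ang v1)
  (is_deriveB (is_derive_sqrt1D v1) (is_derive_sqrt1B v1)).
rewrite (_ : (fun w => _) = ang -
  ((fun w => Num.sqrt (1 + w)) - (fun w => Num.sqrt (1 - w)))); last first.
  by apply/funext => w; rewrite /phi_odd mulrC divfK.
apply: (is_derive_eq H); rewrite /phi_even.
have [a0 b0 a2 b2 ->] := sqrt_factors v1.
move: a0 b0 a2 b2; set a := Num.sqrt (1 + v); set b := Num.sqrt (1 - v) => a0 b0 a2 b2.
by field; rewrite !gt_eqF.
Qed.

(** The derivative is [ang]: the two terms [v / cos theta] cancel. *)
Lemma chi_le_mul_ang : psd_preserving (fun v => v * ang v - chi v).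
Proof.
apply: (psd_preserving_primitive psd_preserving_ang).
  by rewrite ang0 /chi mulr0 expr0n subr0 sqrtr1 !subrr.
move=> v v1.
have H := is_deriveB (is_deriveM (is_derive_id v 1) (is_derive_ang v1))
  (is_deriveB (is_derive_cst (1 : R) v 1) (is_derive_sqrt1B_sqr v1)).
apply: (is_derive_eq H).
rewrite [_ *: _](_ : _ = v * (Num.sqrt (1 - v ^+ 2))^-1)//.
by rewrite [ang v *: 1]mulr1; ring.
Qed.

(** Parity by parity: [2 phi_even <= chi <= v ang] and [2 phi_odd <= ang]. *)
Lemma phi_le_ang : psd_preserving (fun v => v * ang v + ang v - 2 * phi v).
Proof.
have h2 : 0 <= 2 :> R by [].
apply: eq_psd_preserving (psd_preservingD (psd_preservingD chi_le_mul_ang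
  (psd_preservingZ h2 phi_even_le_chi)) phi_odd_le_ang) => v _.
by rewrite phi_even_odd; field.
Qed.

Lemma mul_ang_le_phi : psd_preserving (fun v => 16 * phi v - v * ang v).
Proof.
have h4 : 0 <= 4 :> R by [].
apply: eq_psd_preserving (psd_preservingD (psd_preservingZ h4 mul_phi_le_phi)
  (psd_preservingM psd_preserving_id ang_le_phi)) => v _; ring.
Qed.

(** [kappa0] and [kappa1] are the arc-cosine kernels of degrees zero and one; [kappa] is the
    two-layer kernel on unit vectors. *)
Definition kappa0 v : R := (pi - acos v) / pi.
Definition kappa1 v : R := (v * (pi - acos v) + Num.sqrt (1 - v ^+ 2)) / pi.
Definition kappa (beta v : R) : R :=
  (v + beta ^+ 2) * kappa0 v + kappa1 v + beta ^+ 2.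

Lemma pi_neq0 : pi != 0 :> R.
Proof. by rewrite gt_eqF// pi_gt0. Qed.

Lemma pi_inv_ge0 : 0 <= pi^-1 :> R.
Proof. by rewrite invr_ge0 pi_ge0. Qed.

Lemma psd_preserving_kappa1 : psd_preserving kappa1.
Proof.
have h2 : 0 <= 2^-1 :> R by [].
apply: eq_psd_preserving (psd_preservingD (psd_preservingZ h2 psd_preserving_id)
  (psd_preservingD (psd_preserving_cst pi_inv_ge0)
  (psd_preservingZ pi_inv_ge0 chi_le_mul_ang))) => v _.
by rewrite /kappa1 /ang /chi; move: (pi : R) pi_neq0 => p p0; field.
Qed.

(** With [b = beta ^ 2], [kappa = 1 / pi + 3 b / 2 + v + (2 v ang + b ang - chi) / pi]. Bounding
    [v], [v ang] and [ang] by [2 phi], [16 phi] and [4 phi] gives a constant and a multiple of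
    [phi]; the factor is the sum of the two coefficients. *)
Lemma kappa_le_phi beta : psd_preserving (fun v =>
  (2 + (33 + 4 * beta ^+ 2) / pi + 3 / 2 * beta ^+ 2) * (1 + phi v) - kappa beta v).
Proof.
set b := beta ^+ 2; have b0 : 0 <= b by exact: sqr_ge0.
have c1 : 0 <= 2 + (32 + 4 * b) / pi by rewrite addr_ge0// mulr_ge0 ?pi_inv_ge0//; lra.
have c2 : 0 <= pi^-1 + 3 / 2 * b by rewrite addr_ge0 ?pi_inv_ge0//; lra.
have c3 : 0 <= 2 / pi :> R by rewrite mulr_ge0 ?pi_inv_ge0.
have c4 : 0 <= b / pi by rewrite mulr_ge0 ?pi_inv_ge0.
apply: eq_psd_preserving (psd_preservingD (psd_preserving_cst c1)
  (psd_preservingD (psd_preservingZ c2 psd_preserving_phi)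
  (psd_preservingD id_le_phi
  (psd_preservingD (psd_preservingZ c3 mul_ang_le_phi)
  (psd_preservingD (psd_preservingZ c4 ang_le_phi)
     (psd_preservingZ pi_inv_ge0 psd_preserving_chi)))))) => v _.
by rewrite /kappa /kappa0 /kappa1 /ang /chi -/b; move: (pi : R) pi_neq0 => p p0; field.
Qed.

(** In the same expansion, one [v ang / pi] absorbs [- chi / pi], and [phi] is paid for by
    [v ang + ang]. Since [b / (1 + b)] is at most both [1] and [b], the leftover coefficients of
    [1], [v ang] and [ang] stay nonnegative. *)
Lemma phi_le_kappa beta : psd_preserving (fun v =>
  kappa beta v - beta ^+ 2 / (pi * (1 + beta ^+ 2)) * (1 + phi v)).
Proof.
set b := beta ^+ 2; have b0 : 0 <= b by exact: sqr_ge0.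
have bp : 0 < 1 + b by lra.
have b1 : 1 + b != 0 by rewrite gt_eqF.
have p0 := pi_inv_ge0; have bi : 0 <= (1 + b)^-1 by rewrite invr_ge0 ltW.
have c1 : 0 <= pi^-1 * (1 + b)^-1 + 3 / 2 * b by apply: addr_ge0; [exact: mulr_ge0 | lra].
have c2 : 0 <= pi^-1 * ((1 + b)^-1 * (1 + b / 2)).
  by apply: mulr_ge0 => //; apply: mulr_ge0 => //; nra.
have c3 : 0 <= pi^-1 * ((1 + b)^-1 * (b * (1/2 + b))).
  by apply: mulr_ge0 => //; apply: mulr_ge0 => //; nra.
have c4 : 0 <= pi^-1 * ((1 + b)^-1 * (b / 2)).
  by apply: mulr_ge0 => //; apply: mulr_ge0 => //; nra.
apply: eq_psd_preserving (psd_preservingD (psd_preserving_cst c1)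
  (psd_preservingD psd_preserving_id
  (psd_preservingD (psd_preservingZ p0 chi_le_mul_ang)
  (psd_preservingD (psd_preservingZ c2 (psd_preservingM psd_preserving_id psd_preserving_ang))
  (psd_preservingD (psd_preservingZ c3 psd_preserving_ang)
     (psd_preservingZ c4 phi_le_ang)))))) => v _.
rewrite /kappa /kappa0 /kappa1 /ang /chi -/b.
by move: (pi : R) pi_neq0 => p pn0; field; rewrite b1 pn0.
Qed.

End ArcSine.

(** * The exponential of [phi] *)

Section Exponential.
Context {R : realType}.
Implicit Types (c v : R).

(** Induction through [phi ^ (n + 2) = 2 phi ^ (n + 1) - v phi ^ n]. *)
Lemma phi_exp_le n : psd_preserving (fun v : R => 2 ^+ n * phi v - phi v ^+ n.+1).
Proof.
elim: n => [|n IH].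
  by apply: eq_psd_preserving (psd_preserving_cst (lexx 0)) => v _; rewrite mul1r subrr.
have h2 : 0 <= 2 :> R by [].
apply: eq_psd_preserving (psd_preservingD (psd_preservingZ h2 IH)
  (psd_preservingM (psd_preservingX n psd_preserving_phi) psd_preserving_id)) => v v1.
have E : phi v ^+ 2 = 2 * phi v - v by apply: phi_sqr; have /normr_lt1/andP[_ /ltW] := v1.
move: (phi v) E => p E; have -> : v = 2 * p - p ^+ 2 by rewrite E; ring.
by rewrite !exprS; ring.
Qed.

Lemma cvg_expR (x : R) : \sum_(0 <= k < n) x ^+ k / k`!%:R @[n --> \oo] --> expR x.
Proof. exact: is_cvg_series_exp_coeff. Qed.

Lemma phi_le_expR c : 0 <= c ->
  psd_preserving (fun v => expR (c * phi v) - (1 + c * phi v)).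
Proof.
move=> c0.
(* At least two terms are kept, so that subtracting [1 + c phi] leaves a sum with nonnegative
   coefficients. *)
apply: (@psd_preserving_lim _ (fun n v =>
    \sum_(0 <= k < n.+2) (c * phi v) ^+ k / k`!%:R - (1 + c * phi v))).
  move=> n.
  have FP k : psd_preserving (fun v => (c * phi v) ^+ k.+2 / k.+2`!%:R).
    have h : 0 <= (k.+2`!%:R)^-1 :> R by rewrite invr_ge0.
    apply: eq_psd_preserving (psd_preservingZ h (psd_preservingX k.+2
      (psd_preservingZ c0 psd_preserving_phi))) => v _; exact: mulrC.
  apply: eq_psd_preserving (psd_preserving_sum n FP) => v _.
  rewrite !big_nat_recl// expr0 expr1 fact0 (_ : 1`! = 1%N)// !divr1.
  ring.
move=> v _; apply: cvgB; last exact: cvg_cst.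
have := @cvg_expR (c * phi v).
by rewrite -(cvg_shiftn 2); under eq_fun do rewrite addn2.
Qed.

(** Termwise from the power bounds: the sum over [k >= 1] of [c ^ k 2 ^ (k - 1) / k!] is
    [(exp (2 c) - 1) / 2]. *)
Lemma expR_le_phi c : 0 <= c ->
  psd_preserving (fun v => 1 + (expR (2 * c) - 1) / 2 * phi v - expR (c * phi v)).
Proof.
move=> c0.
apply: (@psd_preserving_lim _ (fun n v =>
    1 + (\sum_(0 <= k < n.+1) (2 * c) ^+ k / k`!%:R - 1) / 2 * phi v
    - \sum_(0 <= k < n.+1) (c * phi v) ^+ k / k`!%:R)).
  move=> n.
  have FP k : psd_preserving (fun v => (c ^+ k.+1 / k.+1`!%:R) *
      (2 ^+ k * phi v - phi v ^+ k.+1)).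
    by apply: psd_preservingZ (phi_exp_le k); rewrite divr_ge0// exprn_ge0.
  apply: eq_psd_preserving (psd_preserving_sum n FP) => v _.
  rewrite !big_nat_recl// !expr0 fact0 !divr1.
  transitivity ((\sum_(0 <= k < n) (2 * c) ^+ k.+1 / k.+1`!%:R) / 2 * phi v -
      \sum_(0 <= k < n) (c * phi v) ^+ k.+1 / k.+1`!%:R); last by ring.
  rewrite !mulr_suml -sumrB; apply: eq_bigr => k _.
  by rewrite !exprMn (exprS 2); field; rewrite pnatr_eq0 -lt0n fact_gt0.
move=> v _.
have sh (x : R) : \sum_(0 <= k < n.+1) x ^+ k / k`!%:R @[n --> \oo] --> expR x.
  by have := @cvg_expR x; rewrite -(cvg_shiftn 1); under eq_fun do rewrite addn1.
apply: cvgB => //; apply: cvgD; first exact: cvg_cst.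
by do 2 apply: cvgMr_tmp; apply: cvgB => //; exact: cvg_cst.
Qed.

End Exponential.

(** * From the open to the closed interval *)

Section ClosedInterval.
Context {R : realType}.
Implicit Types (f g : R -> R) (v : R).

(** Lets a [psd_preserving] function act on kernels reaching modulus one, as happens on the
    diagonal, by shrinking the kernel by [1 - 1 / (n + 1)]. *)
Definition radially_continuous f : Prop := forall v, `|v| <= 1 ->
  f ((1 - harmonic n) * v) @[n --> \oo] --> f v.

Lemma cvg_radius v : (1 - harmonic n) * v @[n --> \oo] --> v.
Proof.
have H : (1 - harmonic n : R) @[n --> \oo] --> (1 - 0 : R).
  by apply: cvgB; [exact: cvg_cst | exact: cvg_harmonic].
have {}H : (1 - harmonic n : R) * v @[n --> \oo] --> (1 - 0) * v by exact: cvgMr_tmp.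
by rewrite subr0 mul1r in H.
Qed.

Lemma radius_bounds n : 0 <= 1 - @harmonic R n < 1.
Proof.
rewrite /harmonic /= subr_ge0 ltrBlDr ltrDl invr_gt0 ltr0n /= andbT.
by rewrite invf_le1// ler1n.
Qed.

Lemma psd_comp_closed (X : Type) (K : X -> X -> R) f :
  psd_preserving f -> radially_continuous f ->
  psd K -> (forall x y, `|K x y| <= 1) -> psd (fun x y => f (K x y)).
Proof.
move=> fP fC KP K1.
apply: (@psd_lim _ _ (fun n x y => f ((1 - harmonic n) * K x y))) => [n|x y].
  have /andP[r0 r1] := radius_bounds n.
  apply: fP (psdZ r0 KP) _ => x y; rewrite normrM (ger0_norm r0).
  by apply: le_lt_trans r1; rewrite ler_piMr.
exact: fC.
Qed.

Lemma radially_continuous_id : radially_continuous (fun v => v).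
Proof. by move=> v _; exact: cvg_radius. Qed.

Lemma radially_continuous_cst a : radially_continuous (fun=> a).
Proof. by move=> v _; exact: cvg_cst. Qed.

Lemma radially_continuousD f g : radially_continuous f -> radially_continuous g ->
  radially_continuous (fun v => f v + g v).
Proof. by move=> fC gC v v1; apply: cvgD; [exact: fC | exact: gC]. Qed.

Lemma radially_continuousB f g : radially_continuous f -> radially_continuous g ->
  radially_continuous (fun v => f v - g v).
Proof. by move=> fC gC v v1; apply: cvgB; [exact: fC | exact: gC]. Qed.

Lemma radially_continuousM f g : radially_continuous f -> radially_continuous g ->
  radially_continuous (fun v => f v * g v).
Proof. by move=> fC gC v v1; apply: cvgM; [exact: fC | exact: gC]. Qed.

Lemma radially_continuous_comp f g : continuous f -> radially_continuous g ->
  radially_continuous (fun v => f (g v)).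
Proof.
move=> fC gC v v1; apply: (@cvg_comp _ _ _ _ f _ (nbhs (g v))); first exact: gC.
exact: fC.
Qed.

Lemma radially_continuous_phi : radially_continuous (@phi R).
Proof.
apply: radially_continuousB; first exact: radially_continuous_cst.
apply: radially_continuous_comp; first exact: sqrt_continuous.
by apply: radially_continuousB;
  [exact: radially_continuous_cst | exact: radially_continuous_id].
Qed.

Lemma radially_continuous_cos :
  radially_continuous (fun v => Num.sqrt (1 - v ^+ 2)).
Proof.
apply: radially_continuous_comp; first exact: sqrt_continuous.
apply: radially_continuousB; first exact: radially_continuous_cst.
by apply: radially_continuousM; exact: radially_continuous_id.
Qed.

(** Reduces continuity of [acos] at the endpoint [1] to that of [asin] at the interior point [0]. *)
Lemma acos_asin v : 0 <= v <= 1 -> acos v = asin (Num.sqrt (1 - v ^+ 2)).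
Proof.
move=> /andP[v0 v1]; have vN1 : -1 <= v <= 1 by lra.
rewrite -sin_acos// sinK// in_itv /=; apply/andP; split.
  by apply: le_trans (acos_ge0 vN1); rewrite oppr_le0 divr_ge0 ?pi_ge0.
rewrite leNgt; apply/negP => H.
have : cos (acos v) < cos (pi / 2).
  have i1 : acos v \in `[0, pi]%R by rewrite in_itv /= acos_ge0 ?acos_lepi.
  have i2 : pi / 2 \in `[0, (pi : R)]%R.
    by rewrite in_itv /=; have := @pi_ge0 R; move: (pi : R) => p; lra.
  by rewrite ltr_cos.
by rewrite acosK ?in_itv// cos_pihalf ltNge v0.
Qed.

Lemma radially_continuous_acos : radially_continuous acos.
Proof.
have acos1 : acos ((1 - harmonic n) * 1) @[n --> \oo] --> acos (1 : R).
  rewrite acos_asin ?lexx ?ler01//.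
  rewrite (_ : (fun n => _) = fun n => asin (Num.sqrt (1 - ((1 - harmonic n) * 1) ^+ 2))).
    have := @radially_continuous_cos 1; rewrite normr1 => /(_ (lexx _)) H.
    apply: (@cvg_comp _ _ _ _ asin _ (nbhs (Num.sqrt (1 - 1 ^+ 2)))); first exact: H.
    by apply: continuous_asin; rewrite expr1n subrr sqrtr0; lra.
  apply/funext => n; apply: acos_asin.
  by have /andP[? /ltW ?] := radius_bounds n; rewrite mulr1; apply/andP.
move=> v; have [v1 _|v1 v1'] := ltP `|v| 1.
  apply: (@cvg_comp _ _ _ _ acos _ (nbhs v)); first exact: cvg_radius.
  exact: continuous_acos (normr_lt1 v1).
have {v1'} : `|v| = 1 by apply/eqP; rewrite eq_le v1 v1'.
move/eqP; rewrite eqr_norml ler01 andbT => /orP[/eqP->//|/eqP->].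
rewrite acosN; last by lra.
rewrite (_ : (fun n => _) = fun n => pi - acos ((1 - harmonic n) * 1)).
  by apply: cvgB => //; exact: cvg_cst.
apply/funext => n; rewrite mulrN acosN//.
by have := radius_bounds n; rewrite mulr1; lra.
Qed.

Lemma radially_continuous_kappa0 : radially_continuous kappa0.
Proof.
apply: radially_continuousM; last exact: radially_continuous_cst.
apply: radially_continuousB; first exact: radially_continuous_cst.
exact: radially_continuous_acos.
Qed.

Lemma radially_continuous_kappa1 : radially_continuous kappa1.
Proof.
apply: radially_continuousM; last exact: radially_continuous_cst.
apply: radially_continuousD; last exact: radially_continuous_cos.
apply: radially_continuousM; first exact: radially_continuous_id.
apply: radially_continuousB; first exact: radially_continuous_cst.
exact: radially_continuous_acos.
Qed.

Lemma radially_continuous_kappa beta : radially_continuous (kappa beta).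
Proof.
apply: radially_continuousD; last exact: radially_continuous_cst.
apply: radially_continuousD; last exact: radially_continuous_kappa1.
apply: radially_continuousM; last exact: radially_continuous_kappa0.
by apply: radially_continuousD;
  [exact: radially_continuous_id | exact: radially_continuous_cst].
Qed.

End ClosedInterval.

(** * Identification of the spaces for a kernel bounded by one *)

Lemma RKHS_equiv (R : realType) (X : Type) (k1 k2 : X -> X -> R) (C1 C2 : R) :
  0 <= C1 -> 0 <= C2 -> psd k1 -> psd k2 ->
  psd (fun x y => C2 * k2 x y - k1 x y) -> psd (fun x y => C1 * k1 x y - k2 x y) ->
  RKHS k1 = RKHS k2.
Proof.
by move=> C10 C20 k1P k2P H1 H2; apply/seteqP; split;
  [exact: RKHS_subset H1 | exact: RKHS_subset H2].
Qed.

Section BoundedKernel.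
Context {R : realType} {X : Type} (K : X -> X -> R).
Hypotheses (KP : psd K) (K1 : forall x y, `|K x y| <= 1).

Let one_phi x y := 1 + phi (K x y).

Lemma psd_one_phi : psd one_phi.
Proof.
apply: psdD; first exact: psd_cst.
exact: psd_comp_closed psd_preserving_phi radially_continuous_phi KP K1.
Qed.

Lemma psd_kappa beta : psd (fun x y => kappa beta (K x y)).
Proof.
have e0 : 0 <= beta ^+ 2 / (pi * (1 + beta ^+ 2)) :> R.
  apply: divr_ge0; first exact: sqr_ge0.
  by apply: mulr_ge0; [exact: pi_ge0 | rewrite addr_ge0 ?sqr_ge0].
have H : psd (fun x y => kappa beta (K x y) -
    beta ^+ 2 / (pi * (1 + beta ^+ 2)) * (1 + phi (K x y))).
  apply: psd_comp_closed (phi_le_kappa beta) _ KP K1.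
  apply: radially_continuousB; first exact: radially_continuous_kappa.
  apply: radially_continuousM; first exact: radially_continuous_cst.
  by apply: radially_continuousD;
    [exact: radially_continuous_cst | exact: radially_continuous_phi].
by apply: eq_psd (psdD H (psdZ e0 psd_one_phi)) => x y; rewrite subrK.
Qed.

Lemma RKHS_kappa beta : 0 < beta ->
  RKHS (fun x y => kappa beta (K x y)) = RKHS one_phi.
Proof.
move=> b0; have b2 : 0 < beta ^+ 2 by exact: exprn_gt0.
set e := beta ^+ 2 / (pi * (1 + beta ^+ 2)).
have e0 : 0 < e by rewrite divr_gt0// mulr_gt0 ?pi_gt0// addr_gt0.
set C := 2 + (33 + 4 * beta ^+ 2) / pi + 3 / 2 * beta ^+ 2.
have C0 : 0 <= C.
  apply: addr_ge0; last by rewrite mulr_ge0 ?sqr_ge0.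
  apply: addr_ge0 => //; apply: mulr_ge0; last exact: pi_inv_ge0.
  by have := sqr_ge0 beta; lra.
have PC : radially_continuous (fun v : R => 1 + phi v).
  by apply: radially_continuousD;
    [exact: radially_continuous_cst | exact: radially_continuous_phi].
apply: (@RKHS_equiv _ _ _ _ e^-1 C); rewrite ?invr_ge0 ?(ltW e0)//.
- exact: psd_kappa.
- exact: psd_one_phi.
- apply: psd_comp_closed (kappa_le_phi beta) _ KP K1.
  apply: radially_continuousB; last exact: radially_continuous_kappa.
  by apply: radially_continuousM; first exact: radially_continuous_cst.
- have ei : 0 <= e^-1 by rewrite invr_ge0 ltW.
  have H : psd (fun x y => kappa beta (K x y) - e * one_phi x y).
    apply: psd_comp_closed (phi_le_kappa beta) _ KP K1.
    apply: radially_continuousB; first exact: radially_continuous_kappa.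
    by apply: radially_continuousM; first exact: radially_continuous_cst.
  apply: eq_psd (psdZ ei H) => x y.
  by rewrite mulrBr mulKf// gt_eqF.
Qed.

Lemma RKHS_laplace c : 0 < c ->
  RKHS (fun x y => expR (- (c * Num.sqrt (1 - K x y)))) = RKHS one_phi.
Proof.
move=> c0; pose L x y := expR (c * phi (K x y)).
have ec0 : 0 <= expR (- c) :> R by exact: expR_ge0.
have LE x y : expR (- (c * Num.sqrt (1 - K x y))) = expR (- c) * L x y.
  by rewrite /L -expRD /phi; congr expR; ring.
have fC (a b : R) : radially_continuous (fun v : R => a + b * phi v).
  apply: radially_continuousD; first exact: radially_continuous_cst.
  by apply: radially_continuousM;
    [exact: radially_continuous_cst | exact: radially_continuous_phi].
have eC : radially_continuous (fun v : R => expR (c * phi v)).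
  apply: radially_continuous_comp; first exact: continuous_expR.
  by apply: radially_continuousM;
    [exact: radially_continuous_cst | exact: radially_continuous_phi].
have phiP : psd (fun x y => phi (K x y)).
  exact: psd_comp_closed psd_preserving_phi radially_continuous_phi KP K1.
have H1 : psd (fun x y => L x y - (1 + c * phi (K x y))).
  by apply: psd_comp_closed (phi_le_expR (ltW c0)) _ KP K1; exact: radially_continuousB.
have H2 : psd (fun x y => 1 + (expR (2 * c) - 1) / 2 * phi (K x y) - L x y).
  by apply: psd_comp_closed (expR_le_phi (ltW c0)) _ KP K1; exact: radially_continuousB.
have LP : psd L.
  apply: eq_psd (psdD H1 (psdD (psd_cst ler01) (psdZ (ltW c0) phiP))) => x y.
  by rewrite subrK.
pose M := (expR (2 * c) - 1) / 2.
have M0 : 0 <= M by have := @expR_ge1Dx R (2 * c); rewrite /M; lra.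
(* The constants come from [(1 + M) (1 + phi) - (1 + M phi) = M + phi] and [(1 + c^-1) (1 + c phi) -
   (1 + phi) = c^-1 + c phi]; the exponentials account for the factor in [LE]. *)
apply: (@RKHS_equiv _ _ _ _ (expR c * (1 + c^-1)) (expR (- c) * (1 + M))).
- by rewrite mulr_ge0 ?expR_ge0// addr_ge0// invr_ge0 ltW.
- by rewrite mulr_ge0// addr_ge0.
- by apply: eq_psd (psdZ ec0 LP) => x y; rewrite LE.
- exact: psd_one_phi.
- apply: eq_psd (psdZ ec0 (psdD H2 (psdD (psd_cst M0) phiP))) => x y.
  by rewrite LE /one_phi -/M; ring.
- have ci : 0 <= c^-1 by rewrite invr_ge0 ltW.
  have c1 : 0 <= 1 + c^-1 by rewrite addr_ge0.
  apply: eq_psd (psdD (psdZ c1 H1) (psdD (psd_cst ci) (psdZ (ltW c0) phiP))) => x y.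
  rewrite LE mulrACA -expRD subrr expR0 mul1r /one_phi.
  by field; rewrite gt_eqF.
Qed.

End BoundedKernel.

(** * The neural tangent kernel recursion on the sphere *)

Section NeuralTangentKernel.
Context {R : realType} {d : nat}.
Implicit Types x y : sphere R d.

Lemma psd_dotp : psd (fun x y => dotp (val x) (val y)).
Proof.
split=> [x y|u]; first by rewrite /dotp; apply: eq_bigr => i _; rewrite mulrC.
have -> : comb_norm2 (fun x y => dotp (val x) (val y)) u =
    \sum_(i < d) comb_norm2 (fun x y => val x ord0 i * val y ord0 i) u.
  rewrite /comb_norm2 [RHS]exchange_big /=; apply: eq_bigr => p _.
  by rewrite [RHS]exchange_big /=; apply: eq_bigr => q _; rewrite mulr_sumr.
by apply: sumr_ge0 => i _; apply: (psd_rank1 (fun x => val x ord0 i)).2.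
Qed.

Lemma kappa1_1 : kappa1 1 = 1 :> R.
Proof.
rewrite /kappa1 acos1 expr1n subrr sqrtr0 subr0 mul1r addr0 divff//.
exact: pi_neq0.
Qed.

(** Since [kappa1] fixes [1], every normalizing square root in the recursion equals one on the
    sphere. *)
Lemma Sigma_diag h x : Sigma h (val x) (val x) = 1.
Proof.
elim: h => [|h IH] /=; first by apply/eqP; exact: (valP x).
by rewrite IH mulr1 sqrtr1 divr1 mulr1; exact: kappa1_1.
Qed.

Lemma Sigma_succ h x y :
  Sigma h.+1 (val x) (val y) = kappa1 (Sigma h (val x) (val y)).
Proof. by rewrite /= !Sigma_diag mulr1 sqrtr1 divr1 mulr1. Qed.

Lemma Sigmadot_succ h x y :
  Sigmadot h.+1 (val x) (val y) = kappa0 (Sigma h (val x) (val y)).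
Proof. by rewrite /= !Sigma_diag mulr1 sqrtr1 divr1. Qed.

Lemma psd_Sigma h : psd (fun x y => Sigma h (val x) (val y)).
Proof.
elim: h => [|h IH]; first exact: psd_dotp.
apply: (@eq_psd _ _ (fun x y => kappa1 (Sigma h (val x) (val y)))) => [x y|].
  by rewrite Sigma_succ.
apply: (psd_comp_closed psd_preserving_kappa1 radially_continuous_kappa1 IH).
by apply: (psd_norm_le1 IH) => x; exact: Sigma_diag.
Qed.

Lemma Sigma_norm h x y : `|Sigma h (val x) (val y)| <= 1.
Proof.
by apply: (psd_norm_le1 (psd_Sigma h)) => z; exact: Sigma_diag.
Qed.

Lemma Theta_succ beta h x y :
  Theta beta h.+1 (val x) (val y) =
  Theta beta h (val x) (val y) * kappa0 (Sigma h (val x) (val y)) +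
  Sigma h.+1 (val x) (val y) + beta ^+ 2.
Proof. by rewrite -Sigmadot_succ. Qed.

Lemma Theta1 beta x y :
  Theta beta 1 (val x) (val y) = kappa beta (dotp (val x) (val y)).
Proof. by rewrite Theta_succ Sigma_succ. Qed.

Lemma psd_Theta_succ beta h : psd (fun x y => Theta beta h (val x) (val y)) ->
  psd (fun x y => Theta beta h.+1 (val x) (val y) - 2^-1 * Theta beta h (val x) (val y)).
Proof.
move=> TP.
have aP : psd (fun x y => ang (Sigma h (val x) (val y))).
  apply: psd_comp_closed psd_preserving_ang _ (psd_Sigma h) (@Sigma_norm h).
  by apply: radially_continuousB;
    [exact: radially_continuous_cst | exact: radially_continuous_acos].
(* [kappa0 = 1 / 2 + ang / pi], and the first summand cancels half of [Theta]. *)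
apply: eq_psd (psdD (psdZ pi_inv_ge0 (psdM TP aP))
  (psdD (psd_Sigma h.+1) (psd_cst (sqr_ge0 beta)))) => x y.
rewrite Theta_succ /kappa0 /ang; move: (Sigma h.+1 _ _) => s.
move: (pi : R) (@pi_neq0 R) => p p0.
by field.
Qed.

Lemma psd_Theta beta h : psd (fun x y => Theta beta h (val x) (val y)).
Proof.
have h2 : 0 <= 2^-1 :> R by [].
elim: h => [|h IH].
  exact: psdD psd_dotp (psd_cst (sqr_ge0 beta)).
by apply: eq_psd (psdD (psd_Theta_succ IH) (psdZ h2 IH)) => x y; rewrite subrK.
Qed.

(** The one-layer comparisons, scaled by powers of two, telescope. *)
Lemma Theta1_le beta h : psd (fun x y =>
  2 ^+ h * Theta beta h.+1 (val x) (val y) - Theta beta 1 (val x) (val y)).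
Proof.
elim: h => [|h IH].
  by apply: eq_psd (psd_cst (lexx 0)) => x y; rewrite mul1r subrr.
have h0 : 0 <= 2 ^+ h.+1 :> R by exact: exprn_ge0.
apply: eq_psd (psdD (psdZ h0 (psd_Theta_succ (psd_Theta beta h.+1))) IH) => x y.
set a := Theta _ h.+2 _ _; set b := Theta _ h.+1 _ _.
by rewrite exprS; field.
Qed.

End NeuralTangentKernel.

Theorem theorem4 (R : realType) (d : nat) (c beta : R) (L : nat) :
  (2 <= d)%N -> 0 < c -> 0 < beta -> (2 <= L)%N ->
  RKHS (@kLap R d c) = RKHS (@kFC R d beta 2) /\
  RKHS (@kFC R d beta 2) `<=` RKHS (@kFC R d beta L).
Proof.
move=> _ c0 b0 L2; split.
  have -> : @kFC R d beta 2 = fun x y => kappa beta (dotp (val x) (val y)).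
    by apply/funext => x; apply/funext => y; exact: Theta1.
  (* [Sigma 0] is the inner product, so this is the Cauchy-Schwarz bound on the sphere. *)
  have K1 := @Sigma_norm R d 0.
  by rewrite (RKHS_kappa psd_dotp K1 b0) -(RKHS_laplace psd_dotp K1 c0).
(* [L = h + 2] corresponds to [Theta] at level [h + 1], hence the constant [2 ^ h]. *)
case: L L2 => [//|[//|h]] _.
apply: (@RKHS_subset _ _ _ _ (2 ^+ h)); first exact: exprn_ge0.
- exact: psd_Theta.
- exact: psd_Theta.
- exact: Theta1_le.
Qed.
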